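(* Let $r_0>0$ and $0<L_0\le 1$ be constants and let $g$ be the charged Nariai metric $$ds^2=\frac{r_0^2}{L_0}\left(-\sin^2 r\,dt^2+dr^2\right)+r_0^2\left(d\theta^2+\sin^2\theta\, d\phi^2\right)$$ in coordinates $(x^1,x^2,x^3,x^4)=(t,r,\theta,\phi)$ (where $\sin r\neq 0$ and $\sin\theta\ne 0$). Then: (i) $g$ is locally symmetric, i.e. $\nabla R=0$; (ii) $g$ is $2$-quasi-Einstein; (iii) $g$ is generalized quasi-Einstein in the sense of Chaki; (iv) $g$ is an $\mathrm{Ein}(2)$-space; (v) $g$ is of Roter type; (vi) $g$ satisfies the pseudosymmetric type conditions $C\cdot R=\frac{1+L_0}{6r_0^2}\,Q(g,R)$ and $P\cdot R=-\frac13\,Q(S,R)$, i.e. it is pseudosymmetric due to the Weyl conformal curvature tensor and Ricci generalized projectively pseudosymmetric, respectively; (vii) the Ricci tensor $S$ is Riemann compatible, conformal compatible and projectively compatible, i.e. $R$-, $C$- and $P$-compatible; (viii) the general form of the compatible tensors for $R$, $C$, $P$, $W$ and $K$ is, in the coordinates $(t,r,\theta,\phi)$, $$(\sigma_{ij})=\begin{pmatrix}\sigma_{11}&\sigma_{12}&0&0\\ \sigma_{12}&\sigma_{22}&0&0\\ 0&0&\sigma_{33}&\sigma_{34}\\ 0&0&\sigma_{34}&\sigma_{44}\end{pmatrix}$$ where the $\sigma_{ij}$ are arbitrary scalars.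
   Context: Conventions ($n=4$ is the dimension; $\nabla$ is the Levi-Civita connection). $R_{pqrs}$ is the Riemann curvature tensor, with the sign and index convention $R_{pqrs}=g(\mathcal R(\partial_p,\partial_q)\partial_s,\partial_r)$, where $\mathcal R(X,Y)Z=\nabla_X\nabla_YZ-\nabla_Y\nabla_XZ-\nabla_{[X,Y]}Z$; $S_{qr}=g^{ps}R_{pqrs}$ is the Ricci tensor, $\kappa=g^{qr}S_{qr}$, $S^t_p=g^{ts}S_{sp}$. (For the metric above, the nonzero components up to symmetry are $R_{1212}=\frac{r_0^2}{L_0}\sin^2r$, $R_{3434}=r_0^2\sin^2\theta$, $S_{11}=\sin^2r$, $S_{22}=S_{33}=-1$, $S_{44}=-\sin^2\theta$, and $\kappa=-\frac{2(1+L_0)}{r_0^2}$.) Set $S^2_{pq}=S_{ps}S^s_q$. Define $C_{pqrs}=R_{pqrs}-\frac{1}{n-2}(g_{ps}S_{qr}-g_{qs}S_{pr}+S_{ps}g_{qr}-S_{qs}g_{pr})+\frac{\kappa}{(n-1)(n-2)}(g_{ps}g_{qr}-g_{qs}g_{pr})$ (conformal curvature), $P_{pqrs}=R_{pqrs}-\frac{1}{n-1}(g_{ps}S_{qr}-g_{qs}S_{pr})$ (projective), $W_{pqrs}=R_{pqrs}-\frac{\kappa}{n(n-1)}(g_{ps}g_{qr}-g_{qs}g_{pr})$ (concircular), $K_{pqrs}=R_{pqrs}-\frac{1}{n-2}(g_{ps}S_{qr}-g_{qs}S_{pr}+S_{ps}g_{qr}-S_{qs}g_{pr})$ (conharmonic).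 For a $(0,4)$-tensor $U$, a symmetric $(0,2)$-tensor $Z$ and a $(0,k)$-tensor $T$: $(U\cdot T)_{p_1\dots p_krs}=-g^{\alpha\beta}[U_{rsp_1\beta}T_{\alpha p_2\dots p_k}+\cdots+U_{rsp_k\beta}T_{p_1\dots p_{k-1}\alpha}]$, $Q(Z,T)_{p_1\dots p_krs}=Z_{sp_1}T_{rp_2\dots p_k}+\cdots+Z_{sp_k}T_{p_1\dots p_{k-1}r}-Z_{rp_1}T_{sp_2\dots p_k}-\cdots-Z_{rp_k}T_{p_1\dots p_{k-1}s}$. Kulkarni–Nomizu product: $(E\wedge A)_{pqrs}=E_{ps}A_{qr}-E_{pr}A_{qs}+E_{qr}A_{ps}-E_{qs}A_{pr}$. Definitions. $m$-quasi-Einstein: the rank of $S-\alpha g$ is $m$ for some scalar $\alpha$. Generalized quasi-Einstein in the sense of Chaki: $S=\alpha g+\beta\,\Pi\otimes\Pi+\gamma(\Pi\otimes\Phi+\Phi\otimes\Pi)$ for some scalars $\alpha,\beta,\gamma$ and $1$-forms $\Pi,\Phi$. $\mathrm{Ein}(2)$: $\alpha_2S^2+\alpha_3S+\alpha_4g=0$ for some scalars with $\alpha_2\neq0$. Roter type: $R=\mu_1\,g\wedge g+\mu_2\,g\wedge S+\mu_3\,S\wedge S$ for some scalars $\mu_i$. A symmetric $(0,2)$-tensor $\sigma$ is $B$-compatible (a compatible tensor for $B$), for a $(0,4)$-tensor $B$, if $\sigma^t_pB_{qrst}+\sigma^t_qB_{rpst}+\sigma^t_rB_{pqst}=0$, where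 $\sigma^t_p=g^{ts}\sigma_{sp}$.
   Formalization: (ii) and (v) are proved only for L_0<1, since both fail at L_0=1 (there g is Einstein but not of Roter type); in (vi) the signs are corrected to C·R = -(1+L_0)/(6r_0^2) Q(g,R) and P·R = +1/3 Q(S,R), as the stated definitions of U·T and Q require. *)

(* Defs.v *)
From mathcomp Require Import all_boot all_order all_algebra.
From mathcomp Require Import all_classical all_reals all_analysis.
Set Implicit Arguments.
Unset Strict Implicit.
Unset Printing Implicit Defensive.
Import Order.TTheory GRing.Theory Num.Theory.
Import numFieldNormedType.Exports.
Local Open Scope classical_set_scope.
Local Open Scope ring_scope.

(* Everything happens in one coordinate chart: a point is the row vector
   x : 'rV[R]_n of its coordinates, the i-th coordinate being x 0 i, and a tensor
   field is the function sending a point to the array of its components in the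
   coordinate frame. *)

Section Fields.
Context {R : realType} {n : nat}.

Definition scalar_field := 'rV[R]_n -> R.
(* vector fields and 1-forms *)
Definition vector_field := 'rV[R]_n -> 'rV[R]_n.
Definition covector_field := 'rV[R]_n -> 'rV[R]_n.
Definition tensor2_field := 'rV[R]_n -> 'M[R]_n.
Definition tensor4 := 'I_n -> 'I_n -> 'I_n -> 'I_n -> R.
Definition tensor4_field := 'rV[R]_n -> tensor4.
Definition tensor5 := 'I_n -> 'I_n -> 'I_n -> 'I_n -> 'I_n -> R.
Definition tensor6 := 'I_n -> 'I_n -> 'I_n -> 'I_n -> 'I_n -> 'I_n -> R.

Definition partial (i : 'I_n) (f : scalar_field) : scalar_field :=
  fun x => 'D_(delta_mx 0 i) f x.

Fixpoint Ck (U : set 'rV[R]_n) (k : nat) (f : scalar_field) : Prop :=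
  if k is k'.+1 then
    (forall i x, U x -> derivable f x (delta_mx 0 i)) /\
    (forall i, Ck U k' (partial i f))
  else forall x, U x -> {for x, continuous f}.

(* meant for an open set U *)
Definition smooth (U : set 'rV[R]_n) (f : scalar_field) : Prop :=
  forall k, Ck U k f.

Definition smooth_form (U : set 'rV[R]_n) (w : covector_field) : Prop :=
  forall i, smooth U (fun x => w x 0 i).

End Fields.

Arguments scalar_field : clear implicits.
Arguments vector_field : clear implicits.
Arguments covector_field : clear implicits.
Arguments tensor2_field : clear implicits.
Arguments tensor4 : clear implicits.
Arguments tensor4_field : clear implicits.
Arguments tensor5 : clear implicits.
Arguments tensor6 : clear implicits.

Section Connection.
Context {R : realType} {n : nat} (g : tensor2_field R n).

(* christoffel x k i j is Gamma^k_ij; the contravariant metric is invmx (g x) *)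
Definition christoffel (x : 'rV[R]_n) (k i j : 'I_n) : R :=
  2^-1 * \sum_l invmx (g x) k l *
    (partial i (fun y => g y j l) x + partial j (fun y => g y i l) x
     - partial l (fun y => g y i j) x).

Definition nabla_vec (X Y : vector_field R n) : vector_field R n :=
  fun x => \row_k \sum_i X x 0 i *
    (partial i (fun y => Y y 0 k) x + \sum_j christoffel x k i j * Y x 0 j).

Definition lie_bracket (X Y : vector_field R n) : vector_field R n :=
  fun x => \row_k \sum_i (X x 0 i * partial i (fun y => Y y 0 k) x
                          - Y x 0 i * partial i (fun y => X y 0 k) x).

Definition curvature_op (X Y Z : vector_field R n) : vector_field R n :=
  fun x => nabla_vec X (nabla_vec Y Z) x - nabla_vec Y (nabla_vec X Z) x
           - nabla_vec (lie_bracket X Y) Z x.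

Definition inner (X Y : vector_field R n) : scalar_field R n :=
  fun x => \sum_i \sum_j g x i j * X x 0 i * Y x 0 j.

Definition frame (i : 'I_n) : vector_field R n := fun _ => delta_mx 0 i.

(* the last two indices are swapped with respect to g(R(X,Y)Z,W), so that a
   sphere has negative Ricci and scalar curvature *)
Definition riemann : tensor4_field R n := fun x p q r s =>
  inner (curvature_op (frame p) (frame q) (frame s)) (frame r) x.

(* nabla4 T x m p q r s is (nabla_m T)_{pqrs} *)
Definition nabla4 (T : tensor4_field R n) (x : 'rV[R]_n) : tensor5 R n :=
  fun m p q r s =>
  partial m (fun y => T y p q r s) x
  - \sum_a (christoffel x a m p * T x a q r s + christoffel x a m q * T x p a r s
            + christoffel x a m r * T x p q a s + christoffel x a m s * T x p q r a).

Definition ricci : tensor2_field R n := fun x =>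
  \matrix_(q, r) \sum_p \sum_s invmx (g x) p s * riemann x p q r s.

Definition scalar_curvature : scalar_field R n := fun x =>
  \sum_q \sum_r invmx (g x) q r * ricci x q r.

(* raise s x t p is s^t_p = g^{tu} s_{up} *)
Definition raise (s : tensor2_field R n) : tensor2_field R n := fun x =>
  \matrix_(t, p) \sum_u invmx (g x) t u * s x u p.

(* S^2_{pq} = S_{ps} S^s_q *)
Definition ricci2 : tensor2_field R n := fun x =>
  \matrix_(p, q) \sum_s ricci x p s * raise ricci x s q.

Definition conformal : tensor4_field R n := fun x p q r s =>
  let G := g x in let S := ricci x in
  riemann x p q r s
  - (n%:R - 2)^-1 * (G p s * S q r - G q s * S p r + S p s * G q r - S q s * G p r)
  + scalar_curvature x / ((n%:R - 1) * (n%:R - 2))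
      * (G p s * G q r - G q s * G p r).

Definition projective : tensor4_field R n := fun x p q r s =>
  let G := g x in let S := ricci x in
  riemann x p q r s - (n%:R - 1)^-1 * (G p s * S q r - G q s * S p r).

Definition concircular : tensor4_field R n := fun x p q r s =>
  let G := g x in
  riemann x p q r s
  - scalar_curvature x / (n%:R * (n%:R - 1)) * (G p s * G q r - G q s * G p r).

Definition conharmonic : tensor4_field R n := fun x p q r s =>
  let G := g x in let S := ricci x in
  riemann x p q r s
  - (n%:R - 2)^-1 * (G p s * S q r - G q s * S p r + S p s * G q r - S q s * G p r).

(* (U . T)_{p1 p2 p3 p4 r s} for a (0,4)-tensor T *)
Definition curv_act (U T : tensor4_field R n) (x : 'rV[R]_n) : tensor6 R n :=
  fun p1 p2 p3 p4 r s =>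
  - \sum_a \sum_b invmx (g x) a b *
      (U x r s p1 b * T x a p2 p3 p4 + U x r s p2 b * T x p1 a p3 p4
       + U x r s p3 b * T x p1 p2 a p4 + U x r s p4 b * T x p1 p2 p3 a).

(* Q(Z,T)_{p1 p2 p3 p4 r s} for a (0,4)-tensor T; with these signs
   R . T = K Q(g,T) when g has constant sectional curvature K *)
Definition tachibana (Z : tensor2_field R n) (T : tensor4_field R n)
    (x : 'rV[R]_n) : tensor6 R n :=
  fun p1 p2 p3 p4 r s =>
    Z x s p1 * T x r p2 p3 p4 + Z x s p2 * T x p1 r p3 p4
  + Z x s p3 * T x p1 p2 r p4 + Z x s p4 * T x p1 p2 p3 r
  - Z x r p1 * T x s p2 p3 p4 - Z x r p2 * T x p1 s p3 p4
  - Z x r p3 * T x p1 p2 s p4 - Z x r p4 * T x p1 p2 p3 s.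

Definition kulkarni_nomizu (E A : tensor2_field R n) : tensor4_field R n :=
  fun x p q r s =>
    E x p s * A x q r - E x p r * A x q s + E x q r * A x p s - E x q s * A x p r.

Definition symmetric_field (U : set 'rV[R]_n) (s : tensor2_field R n) : Prop :=
  forall x, U x -> (s x)^T = s x.

Definition locally_symmetric (U : set 'rV[R]_n) : Prop :=
  forall x, U x -> forall m p q r s, nabla4 riemann x m p q r s = 0.

Definition quasi_einstein (U : set 'rV[R]_n) (m : nat) : Prop :=
  exists2 alpha : scalar_field R n, smooth U alpha &
    forall x, U x -> \rank (ricci x - alpha x *: g x) = m.

Definition chaki_quasi_einstein (U : set 'rV[R]_n) : Prop :=
  exists (alpha beta gamma : scalar_field R n) (Pi Phi : covector_field R n),
    [/\ smooth U alpha, smooth U beta & smooth U gamma] /\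
    [/\ smooth_form U Pi, smooth_form U Phi &
      forall x, U x -> forall p q,
        ricci x p q = alpha x * g x p q + beta x * (Pi x 0 p * Pi x 0 q)
          + gamma x * (Pi x 0 p * Phi x 0 q + Phi x 0 p * Pi x 0 q)].

Definition ein2 (U : set 'rV[R]_n) : Prop :=
  exists a2 a3 a4 : scalar_field R n,
    [/\ smooth U a2, smooth U a3 & smooth U a4] /\
    forall x, U x -> a2 x != 0 /\
      a2 x *: ricci2 x + a3 x *: ricci x + a4 x *: g x = 0.

Definition roter_type (U : set 'rV[R]_n) : Prop :=
  exists m1 m2 m3 : scalar_field R n,
    [/\ smooth U m1, smooth U m2 & smooth U m3] /\
    forall x, U x -> forall p q r s,
      riemann x p q r s = m1 x * kulkarni_nomizu g g x p q r s
        + m2 x * kulkarni_nomizu g ricci x p q r s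
        + m3 x * kulkarni_nomizu ricci ricci x p q r s.

Definition compatible (U : set 'rV[R]_n) (s : tensor2_field R n)
    (B : tensor4_field R n) : Prop :=
  symmetric_field U s /\
  forall x, U x -> forall p q r u,
    \sum_t (raise s x t p * B x q r u t + raise s x t q * B x r p u t
            + raise s x t r * B x p q u t) = 0.

End Connection.

Section Nariai.
Context {R : realType}.

(* the coordinates (t, r, theta, phi) are x 0 0, x 0 1, x 0 2, x 0 3 *)
Definition nariai_dom : set 'rV[R]_4 :=
  [set x | sin (x 0 1) != 0 /\ sin (x 0 2) != 0].

Definition nariai (r0 L0 : R) : tensor2_field R 4 := fun x =>
  diag_mx (\row_i [:: - (r0 ^+ 2 / L0 * sin (x 0 1) ^+ 2); r0 ^+ 2 / L0;
                      r0 ^+ 2; r0 ^+ 2 * sin (x 0 2) ^+ 2]`_i).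

(* the two diagonal 2x2 blocks are unconstrained, the other entries vanish *)
Definition block_2_2 (s : 'M[R]_4) : Prop :=
  exists s11 s12 s22 s33 s34 s44 : R,
    s = \matrix_(i, j) nth 0 (nth [::] [:: [:: s11; s12; 0;   0];
                                          [:: s12; s22; 0;   0];
                                          [:: 0;   0;   s33; s34];
                                          [:: 0;   0;   s34; s44]] i) j.

End Nariai.

(* Main.v *)
Require Import Defs.
From mathcomp Require Import all_boot all_order all_algebra.
From mathcomp Require Import all_classical all_reals all_analysis.
From mathcomp Require Import ring lra.
Import Order.TTheory GRing.Theory Num.Theory.
Import numFieldNormedType.Exports.
Local Open Scope classical_set_scope.
Local Open Scope ring_scope.

(** The charged Nariai metric is the product of two surfaces: the (t, r)-part
    and the (theta, phi)-part both have constant Gauss curvature, namely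
    [L0 / r0 ^+ 2] and [(r0 ^+ 2)^-1]. Hence the Ricci tensor is a multiple of the
    metric on each factor, and the whole theorem is about tensors built from the
    two partial metrics [factor_metric false] and [factor_metric true], abbreviated
    [E i] below.

    The analytic work is one computation in coordinates. The Christoffel symbols
    are functions of a single coordinate, so their derivatives reduce to
    one-variable calculus ([is_derive_coord]), and [riemann_nariai] identifies the
    curvature. It has the shape [block_curvature b],
    [\sum_i \sum_j b i j * (E i p r * E j q s - E i q r * E j p s)], for a 2 x 2
    array of constants [b]; so do the conformal, projective, concircular and
    conharmonic tensors, because the corrections that define them are products of
    the metric and the Ricci tensor.

    From there on everything is algebra in the [E i]. They are parallel
    ([is_derive_factor_metric]), which gives local symmetry by the Leibniz rule.
    The Ricci tensor minus one of its eigenvalues times the metric is a multiple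
    of one [E i]: this has rank 2 when [L0 < 1] (2-quasi-Einstein), and for the Lorentzian factor
    it is a symmetric product of two null forms (Chaki). The two eigenvalues of
    the Ricci operator are the roots of the Ein(2) polynomial, and the Roter
    decomposition solves a linear system that is regular when they differ.

    In the cyclic sum that defines compatibility, the terms pairing [E i] with
    itself and those pairing it with the other factor compete: an entry of sigma
    mixing the two factors is multiplied by [b false false - b false true], and
    block-diagonal symmetric sigma satisfy the condition identically. This is
    [compatible_block_curvature], and it covers all five tensors at once. Finally,
    a block curvature acting on the Riemann tensor only sees the mixed coefficients
    [b i (~~ i)], because the curvature operators of a single factor annihilate the
    Riemann tensor; the remaining terms are a Tachibana tensor
    ([curv_act_block_curvature]), which gives both pseudosymmetry conditions. *)

(** * Functions of one coordinate *)

Lemma is_derive_coord {R : realType} {n : nat} (F : R -> R) (dF : R)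
    (i j : 'I_n) (x : 'rV[R]_n) :
  is_derive (x 0 j) 1 F dF ->
  is_derive x (delta_mx 0 i) (fun y : 'rV[R]_n => F (y 0 j))
    ((i == j)%:R * dF).
Proof.
move=> [dFx eqdF].
have E (h : R) : (h *: delta_mx 0 i + x) 0 j = h * (i == j)%:R + x 0 j.
  by rewrite !mxE eqxx eq_sym.
have [eij|nij] := eqVneq i j.
- have EF : (fun h : R => h^-1 *:
        (F ((h *: (delta_mx 0 i : 'rV[R]_n) + x) 0 j) - F (x 0 j)))
      = (fun h : R => h^-1 *: (F (h *: 1 + x 0 j) - F (x 0 j))).
    by apply/funext => h; rewrite E eij eqxx.
  apply: DeriveDef; first by rewrite /derivable EF.
  by rewrite /derive EF mul1r -eqdF.
have EF : (fun h : R => h^-1 *: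
      (F ((h *: (delta_mx 0 i : 'rV[R]_n) + x) 0 j) - F (x 0 j)))
    = (fun h : R => 0).
  by apply/funext => h; rewrite E (negbTE nij) mulr0 add0r subrr scaler0.
apply: DeriveDef; first by rewrite /derivable EF; exact: is_cvg_cst.
by rewrite /derive EF mul0r lim_cst.
Qed.

Lemma partial_coord {R : realType} {n : nat} (F : R -> R) (dF : R)
    (i j : 'I_n) (x : 'rV[R]_n) :
  is_derive (x 0 j) 1 F dF ->
  partial i (fun y => F (y 0 j)) x = (i == j)%:R * dF.
Proof. by move=> /(is_derive_coord _ _ i) [_ <-]. Qed.

Lemma partial_cst {R : realType} {n : nat} (c : R) (i : 'I_n) (x : 'rV[R]_n) :
  partial i (fun=> c) x = 0.
Proof. exact: derive_cst. Qed.

Lemma partial_near {R : realType} {n : nat} (f f' : scalar_field R n)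
    (i : 'I_n) (U : set 'rV[R]_n) (x : 'rV[R]_n) :
  nbhs x U -> (forall y, U y -> f y = f' y) -> partial i f x = partial i f' x.
Proof. by move=> Ux ff'; apply: near_eq_derive; apply: filterS Ux. Qed.

Lemma smooth_cst {R : realType} {n : nat} (U : set 'rV[R]_n) (c : R) :
  smooth U (fun=> c).
Proof.
move=> k; elim: k c => [|k IH] c /=; first by move=> x _; exact: cst_continuous.
split=> [i x _|i]; first exact: derivable_cst.
suff -> : partial i (fun=> c) = (fun=> 0) :> ('rV[R]_n -> R) by exact: IH.
by apply/funext => x; rewrite partial_cst.
Qed.

(** Differentiating swaps [sin] and [cos] up to a constant, so the induction on
    the order of differentiability has to carry both together with an arbitrary
    constant factor. *)
Lemma smooth_sin_coord {R : realType} {n : nat} (U : set 'rV[R]_n) (j : 'I_n)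
    (c : R) :
  smooth U (fun x => c * sin (x 0 j)).
Proof.
move=> k; have [] //: Ck U k (fun x : 'rV[R]_n => c * sin (x 0 j)) /\
  Ck U k (fun x : 'rV[R]_n => c * cos (x 0 j)).
have dsin (a t : R) : is_derive t 1 (fun u => a * sin u) (a * cos t).
  exact: is_derive_eq.
have dcos (a t : R) : is_derive t 1 (fun u => a * cos u) (a * - sin t).
  exact: is_derive_eq.
elim: k c => [|k IH] c.
  have cj (x : 'rV[R]_n) : {for x, continuous (fun y : 'rV[R]_n => y 0 j)}.
    exact: coord_continuous.
  split=> x _; apply: continuousM; try exact: cst_continuous.
    exact: (continuous_comp (cj x) (@continuous_sin _ _)).
  exact: (continuous_comp (cj x) (@continuous_cos _ _)).
split; split=> [i x _|i].
- by have [] := is_derive_coord _ _ i j x (dsin c (x 0 j)).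
- have -> : partial i (fun x : 'rV[R]_n => c * sin (x 0 j))
      = (fun x => ((i == j)%:R * c) * cos (x 0 j)).
    by apply/funext => x; rewrite (partial_coord _ _ _ _ _ (dsin c _)) mulrA.
  by have [] := IH ((i == j)%:R * c).
- by have [] := is_derive_coord _ _ i j x (dcos c (x 0 j)).
- have -> : partial i (fun x : 'rV[R]_n => c * cos (x 0 j))
      = (fun x => (- ((i == j)%:R * c)) * sin (x 0 j)).
    by apply/funext => x; rewrite (partial_coord _ _ _ _ _ (dcos c _)); ring.
  by have [] := IH (- ((i == j)%:R * c)).
Qed.

(** The Christoffel symbols involve [invmx (g x)], which is the inverse metric only
    on the domain; differentiating them requires the domain to be open. *)
Lemma nbhs_nariai_dom {R : realType} (x : 'rV[R]_4) :
  nariai_dom x -> nbhs x (@nariai_dom R).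
Proof.
have cs (j : 'I_4) : {for x, continuous (fun y : 'rV[R]_4 => sin (y 0 j))}.
  apply: (@continuous_comp _ _ _ (fun y : 'rV[R]_4 => y 0 j) sin).
    exact: coord_continuous.
  exact: continuous_sin.
case=> s1 s2; apply: filterI.
  exact: (cvgr_neq0 _ (cs 1) s1).
exact: (cvgr_neq0 _ (cs 2) s2).
Qed.

(** * Curvature of a coordinate frame *)

Lemma sum_delta {R : realType} {n : nat} (F : 'I_n -> R) (i : 'I_n) :
  \sum_k F k *+ (k == i) = F i.
Proof. by under eq_bigr do rewrite mulrb; rewrite -big_mkcond big_pred1_eq. Qed.

Lemma nabla_frame {R : realType} {n : nat} (g : tensor2_field R n)
    (i : 'I_n) (Y : vector_field R n) (x : 'rV[R]_n) (k : 'I_n) :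
  nabla_vec g (frame i) Y x 0 k =
  partial i (fun y => Y y 0 k) x + \sum_j christoffel g x k i j * Y x 0 j.
Proof.
rewrite mxE -[RHS](sum_delta (fun i => _ + \sum_j christoffel g x k i j * _)).
by apply: eq_bigr => j _; rewrite mxE eqxx mulr_natl.
Qed.

Lemma nabla_frame_frame {R : realType} {n : nat} (g : tensor2_field R n)
    (i j : 'I_n) (x : 'rV[R]_n) :
  nabla_vec g (frame i) (frame j) x = \row_k christoffel g x k i j.
Proof.
apply/rowP => k; rewrite nabla_frame mxE.
rewrite (_ : (fun _ => _) = (fun=> (frame j x : 'rV[R]_n) 0 k)) //.
rewrite partial_cst add0r -[RHS](sum_delta (fun j => christoffel g x k i j)).
by apply: eq_bigr => l _; rewrite mxE eqxx mulr_natr.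
Qed.

(** Coordinate fields commute, so only the two second-order terms survive. *)
Lemma curvature_frame {R : realType} {n : nat} (g : tensor2_field R n)
    (p q s k : 'I_n) (x : 'rV[R]_n) :
  curvature_op g (frame p) (frame q) (frame s) x 0 k =
  partial p (fun y => christoffel g y k q s) x
  - partial q (fun y => christoffel g y k p s) x
  + \sum_m (christoffel g x k p m * christoffel g x m q s
            - christoffel g x k q m * christoffel g x m p s).
Proof.
have lie0 : lie_bracket (frame p) (frame q) = (fun=> 0 : 'rV[R]_n).
  apply/funext => y; apply/rowP => l; rewrite [LHS]mxE [RHS]mxE big1 // => m _.
  rewrite (partial_cst ((frame q x : 'rV[R]_n) 0 l)).
  by rewrite (partial_cst ((frame p x : 'rV[R]_n) 0 l)) !mulr0 subrr.
have nabla0 Z : nabla_vec g (fun=> 0) Z x = 0.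
  by apply/rowP => l; rewrite !mxE big1 // => m _; rewrite mxE mul0r.
have nfE i j : nabla_vec g (frame i) (frame j)
    = (fun y => \row_k christoffel g y k i j).
  by apply/funext => y; exact: nabla_frame_frame.
rewrite /curvature_op lie0 nabla0 subr0 !nfE.
have -> (u v : 'rV[R]_n) : (u - v) 0 k = u 0 k - v 0 k by rewrite !mxE.
rewrite !nabla_frame sumrB.
have pE i j : (fun y => (\row_k0 christoffel g y k0 i j) 0 k)
    = (fun y => christoffel g y k i j) by apply/funext => y; rewrite mxE.
rewrite !pE opprD addrACA; congr (_ + (_ - _)).
  by apply: eq_bigr => m _; rewrite mxE.
by apply: eq_bigr => m _; rewrite mxE.
Qed.

(** * The Christoffel symbols of the Nariai metric *)

(** [false] for the coordinates t and r, [true] for theta and phi. *)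
Definition factor (p : 'I_4) : bool := (2 <= p)%N.

Definition nariai_diag {R : realType} (r0 L0 : R) (x : 'rV[R]_4)
    (p : 'I_4) : R :=
  [:: - (r0 ^+ 2 / L0 * sin (x 0 1) ^+ 2); r0 ^+ 2 / L0;
      r0 ^+ 2; r0 ^+ 2 * sin (x 0 2) ^+ 2]`_p.

(** The only coordinate, r or theta, on which the metric of the factor of [k]
    depends. *)
Definition factor_coord (k : 'I_4) : 'I_4 := if factor k then 2 else 1.

Definition nariai_christoffel {R : realType} (k i j : 'I_4) (u : R) : R :=
  match nat_of_ord k, nat_of_ord i, nat_of_ord j with
  | 0%N, 0%N, 1%N | 0%N, 1%N, 0%N | 3%N, 2%N, 3%N | 3%N, 3%N, 2%N => cos u / sin u
  | 1%N, 0%N, 0%N => sin u * cos u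
  | 2%N, 3%N, 3%N => - (sin u * cos u)
  | _, _, _ => 0
  end.

Definition nariai_christoffel_deriv {R : realType} (k i j : 'I_4) (u : R) : R :=
  match nat_of_ord k, nat_of_ord i, nat_of_ord j with
  | 0%N, 0%N, 1%N | 0%N, 1%N, 0%N | 3%N, 2%N, 3%N | 3%N, 3%N, 2%N =>
      - (1 + (cos u / sin u) ^+ 2)
  | 1%N, 0%N, 0%N => cos u ^+ 2 - sin u ^+ 2
  | 2%N, 3%N, 3%N => sin u ^+ 2 - cos u ^+ 2
  | _, _, _ => 0
  end.

Lemma is_derive_nariai_christoffel {R : realType} (k i j : 'I_4) (u : R) :
  sin u != 0 ->
  is_derive u 1 (nariai_christoffel k i j) (nariai_christoffel_deriv k i j u).
Proof.
move=> su.
have dcot : is_derive u 1 (fun u => cos u / sin u) (- (1 + (cos u / sin u) ^+ 2)).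
  have dV := is_deriveV su (is_derive_sin u).
  by apply: is_derive_eq; rewrite /GRing.scale /=; field.
have dsc : is_derive u 1 (fun u : R => sin u * cos u) (cos u ^+ 2 - sin u ^+ 2).
  by apply: is_derive_eq; rewrite /GRing.scale /=; ring.
have dscN : is_derive u 1 (fun u : R => - (sin u * cos u))
    (sin u ^+ 2 - cos u ^+ 2).
  by apply: is_derive_eq; rewrite /GRing.scale /=; ring.
have d0 : is_derive u 1 (fun=> 0 : R) (0 : R) by exact: is_derive_cst.
case: k i j => -[|[|[|[|//]]]] ? [[|[|[|[|//]]]] ?] [[|[|[|[|//]]]] ?];
  rewrite /nariai_christoffel_deriv ?/nariai_christoffel //=.
Qed.

Section Nariai.
Context {R : realType} (r0 L0 : R) (hr0 : 0 < r0) (hL0 : 0 < L0).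
Local Notation g := (nariai r0 L0).
Local Notation U := (@nariai_dom R).
Local Notation h := (nariai_diag r0 L0).

Lemma nariaiE (x : 'rV[R]_4) (p q : 'I_4) : g x p q = h x p *+ (p == q).
Proof. by rewrite !mxE. Qed.

Lemma nariai_diag_neq0 (x : 'rV[R]_4) (p : 'I_4) : U x -> h x p != 0.
Proof.
move=> [s1 s2]; have r0n : r0 != 0 by rewrite gt_eqF.
have L0n : L0 != 0 by rewrite gt_eqF.
by case: p => -[|[|[|[|//]]]] ?; rewrite /nariai_diag /= ?oppr_eq0
  ?mulf_neq0 ?expf_neq0 ?invr_neq0.
Qed.

Lemma invmx_nariai (x : 'rV[R]_4) (p q : 'I_4) :
  U x -> invmx (g x) p q = (h x p)^-1 *+ (p == q).
Proof.
move=> Ux; pose d := \row_i (h x i)^-1.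
have gd : g x *m diag_mx d = 1%:M.
  rewrite mulmx_diag; apply/matrixP => i j; rewrite !mxE.
  have [->|//] := eqVneq i j.
  by rewrite mulfV // nariai_diag_neq0.
have [gu _] := mulmx1_unit gd.
by rewrite -[invmx _]mulmx1 -gd mulKmx // !mxE.
Qed.

Lemma sum_invmx (x : 'rV[R]_4) (p : 'I_4) (F : 'I_4 -> R) :
  U x -> \sum_q invmx (g x) p q * F q = (h x p)^-1 * F p.
Proof.
move=> Ux; rewrite -[RHS](sum_delta (fun q => (h x q)^-1 * F q)).
apply: eq_bigr => q _; rewrite invmx_nariai // eq_sym.
by have [->|_] := eqVneq p q; rewrite ?mulr1n // mul0r.
Qed.

Definition nariai_deriv (x : 'rV[R]_4) (m p : 'I_4) : R :=
  match nat_of_ord m, nat_of_ord p with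
  | 1%N, 0%N => - (r0 ^+ 2 / L0 * (2 * sin (x 0 1) * cos (x 0 1)))
  | 2%N, 3%N => r0 ^+ 2 * (2 * sin (x 0 2) * cos (x 0 2))
  | _, _ => 0
  end.

Lemma is_derive_nariai (x : 'rV[R]_4) (m p q : 'I_4) :
  is_derive x (delta_mx 0 m) (fun y => g y p q) (nariai_deriv x m p *+ (p == q)).
Proof.
have -> : (fun y => g y p q) = (fun y => h y p *+ (p == q)).
  by apply/funext => y; rewrite nariaiE.
case: eqVneq => [_|_]; last exact: is_derive_cst.
rewrite mulr1n.
have d1 (t : R) : is_derive t 1 (fun u => - (r0 ^+ 2 / L0 * sin u ^+ 2))
    (- (r0 ^+ 2 / L0 * (2 * sin t * cos t))).
  by apply: is_derive_eq; rewrite /GRing.scale /=; ring.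
have d2 (t : R) : is_derive t 1 (fun u => r0 ^+ 2 * sin u ^+ 2)
    (r0 ^+ 2 * (2 * sin t * cos t)).
  by apply: is_derive_eq; rewrite /GRing.scale /=; ring.
case: p => -[|[|[|[|//]]]] ?; rewrite /nariai_diag /nariai_deriv /=.
- apply: is_derive_eq (is_derive_coord _ _ m 1 x (d1 _)) _.
  by case: m => -[|[|[|[|//]]]] ? /=; rewrite ?mul0r ?mul1r.
- apply: is_derive_eq (is_derive_cst _ _ _) _.
  by case: m => -[|[|[|[|//]]]].
- apply: is_derive_eq (is_derive_cst _ _ _) _.
  by case: m => -[|[|[|[|//]]]].
- apply: is_derive_eq (is_derive_coord _ _ m 2 x (d2 _)) _.
  by case: m => -[|[|[|[|//]]]] ? /=; rewrite ?mul0r ?mul1r.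
Qed.

Lemma partial_nariai (x : 'rV[R]_4) (m p q : 'I_4) :
  partial m (fun y => g y p q) x = nariai_deriv x m p *+ (p == q).
Proof. by have [] := is_derive_nariai x m p q. Qed.

Lemma christoffel_nariai (x : 'rV[R]_4) (k i j : 'I_4) : U x ->
  christoffel g x k i j = nariai_christoffel k i j (x 0 (factor_coord k)).
Proof.
move=> Ux; rewrite /christoffel sum_invmx // !partial_nariai.
case: (Ux) => s1 s2; have r0n : r0 != 0 by rewrite gt_eqF.
have L0n : L0 != 0 by rewrite gt_eqF.
case: k i j => -[|[|[|[|//]]]] ? [[|[|[|[|//]]]] ?] [[|[|[|[|//]]]] ?];
  rewrite /nariai_deriv /nariai_christoffel /nariai_diag /factor_coord /factor /=
    ?mulr1n ?mulr0n ?subr0 ?addr0 ?sub0r ?mulr0 //; field;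
  by rewrite ?r0n ?L0n ?s1 ?s2.
Qed.

Lemma partial_christoffel_nariai (x : 'rV[R]_4) (m k i j : 'I_4) : U x ->
  partial m (fun y => christoffel g y k i j) x =
  (m == factor_coord k)%:R
    * nariai_christoffel_deriv k i j (x 0 (factor_coord k)).
Proof.
move=> Ux; rewrite (partial_near _ _ _ _ _ (nbhs_nariai_dom _ Ux)
  (fun y Uy => christoffel_nariai y k i j Uy)).
apply/partial_coord/is_derive_nariai_christoffel.
by rewrite /factor_coord; case: factor; case: Ux.
Qed.

(** * The Riemann tensor *)

Definition gauss (b : bool) : R := if b then (r0 ^+ 2)^-1 else L0 / r0 ^+ 2.
Arguments gauss : simpl never.

Definition factor_metric (b : bool) : tensor2_field R 4 := fun x =>
  \matrix_(p, q) (h x p *+ ((p == q) && (factor p == b))).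
Local Notation E := factor_metric.

(** Skew in the first two indices; [b i j] weighs the factor of the first and of
    the second index. The diagonal coefficients give the curvature tensors of the
    factors, the others the cross terms of a Kulkarni-Nomizu product. *)
Definition block_curvature (b : bool -> bool -> R) : tensor4_field R 4 :=
  fun x p q r s => \sum_i \sum_j
    b i j * (E i x p r * E j x q s - E i x q r * E j x p s).

Lemma riemann_christoffel (x : 'rV[R]_4) (p q r s : 'I_4) :
  riemann g x p q r s = h x r *
  (partial p (fun y => christoffel g y r q s) x
  - partial q (fun y => christoffel g y r p s) x
  + \sum_m (christoffel g x r p m * christoffel g x m q s
            - christoffel g x r q m * christoffel g x m p s)).
Proof.
rewrite -curvature_frame /riemann /inner exchange_big /=.
rewrite -[RHS](sum_delta (fun r => h x r * _ 0 r)).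
apply: eq_bigr => j _; rewrite mxE eqxx /= -mulr_suml mulr_natr.
congr (_ *+ _); rewrite -[RHS](sum_delta (fun r => h x r * _ 0 r)).
by apply: eq_bigr => i _; rewrite nariaiE mulrnAl.
Qed.

Lemma riemann_anti (x : 'rV[R]_4) (p q r s : 'I_4) :
  riemann g x p q r s = - riemann g x q p r s.
Proof.
rewrite !riemann_christoffel -mulrN opprD opprB -sumrN; congr (_ * (_ + _)).
by apply: eq_bigr => m _; rewrite opprB.
Qed.

Lemma block_curvature_anti (b : bool -> bool -> R) (x : 'rV[R]_4)
    (p q r s : 'I_4) :
  block_curvature b x p q r s = - block_curvature b x q p r s.
Proof. by rewrite /block_curvature !big_bool /=; ring. Qed.

Definition riemann_coef (i j : bool) : R := if i == j then gauss i else 0.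

(** The Riemann tensor of a product is the sum of those of the factors, which have
    constant curvature. This is checked on components; only the case [p <= q] has to
    be treated, as both sides are skew in [p] and [q]. *)
Lemma riemann_nariai (x : 'rV[R]_4) (p q r s : 'I_4) : U x ->
  riemann g x p q r s =
  block_curvature riemann_coef x p q r s.
Proof.
move=> Ux; wlog pq : p q / (p <= q)%N.
  case: (leqP p q) => [|/ltnW] pq H; first exact: H.
  by rewrite riemann_anti H // -block_curvature_anti.
rewrite riemann_christoffel !partial_christoffel_nariai //.
under eq_bigr do rewrite !christoffel_nariai //.
rewrite /block_curvature !big_bool /= !mxE !big_ord_recl big_ord0.
case: (Ux) => s1 s2; have r0n : r0 != 0 by rewrite gt_eqF.
have L0n : L0 != 0 by rewrite gt_eqF.
rewrite /nariai_christoffel /nariai_christoffel_deriv /nariai_diag.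
rewrite /factor_coord /factor /riemann_coef /gauss.
case: p pq => -[|[|[|[|//]]]] ?; case: q => -[|[|[|[|//]]]] ? //= _;
  case: r => -[|[|[|[|//]]]] ?; case: s => -[|[|[|[|//]]]] ? /=;
  by [ring | field; rewrite ?s1 ?s2 ?r0n ?L0n].
Qed.

(** * Contraction with the inverse metric *)

Lemma factor_metricC (b : bool) (x : 'rV[R]_4) (p q : 'I_4) :
  E b x p q = E b x q p.
Proof. by rewrite !mxE eq_sym; case: eqVneq => // ->. Qed.

Lemma factor_metric_proj (i j : bool) (x : 'rV[R]_4) (p q : 'I_4) :
  E i x p q *+ (factor p == j) = E i x p q *+ (i == j).
Proof.
rewrite mxE; have [->|] := eqVneq (factor p) i; first by [].
by rewrite andbF mulr0n !mul0rn.
Qed.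

Lemma nariai_sum (x : 'rV[R]_4) (p q : 'I_4) :
  g x p q = E true x p q + E false x p q.
Proof.
by rewrite nariaiE !mxE; case: factor; rewrite ?andbT ?andbF ?addr0 ?add0r.
Qed.

Lemma factor_metric_contract (i : bool) (x : 'rV[R]_4) (p : 'I_4)
    (F : 'I_4 -> R) : U x ->
  \sum_a (h x a)^-1 * (E i x p a * F a) = F p *+ (factor p == i).
Proof.
move=> Ux; rewrite -[RHS](sum_delta (fun a => F a *+ (factor a == i))).
apply: eq_bigr => a _; rewrite mxE eq_sym.
have [->|_] := eqVneq a p; last by rewrite mul0r mulr0.
rewrite mulr1n; case: eqVneq => _; last by rewrite mul0r mulr0.
by rewrite !mulr1n mulKf // nariai_diag_neq0.
Qed.

Lemma block_curvature_contract (b : bool -> bool -> R) (x : 'rV[R]_4)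
    (p q r : 'I_4) (F : 'I_4 -> R) : U x ->
  \sum_a (h x a)^-1 * (block_curvature b x p q r a * F a) =
  \sum_i \sum_j b i j * (E i x p r * (F q *+ (factor q == j))
                         - E i x q r * (F p *+ (factor p == j))).
Proof.
move=> Ux; rewrite !big_bool /= -!(factor_metric_contract _ x) //.
by rewrite /block_curvature !big_ord_recl !big_ord0 !big_bool /=; ring.
Qed.

Lemma factor_metric_trace (i : bool) (x : 'rV[R]_4) : U x ->
  \sum_a (h x a)^-1 * E i x a a = 2.
Proof.
move=> Ux; transitivity (\sum_(a < 4) ((factor a == i)%:R : R)).
  apply: eq_bigr => a _; rewrite mxE eqxx /=.
  by case: eqVneq => _; rewrite ?mulr0 // mulr1n mulVf // nariai_diag_neq0.
by rewrite !big_ord_recl big_ord0 /factor /=; case: i => /=; ring.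
Qed.

(** * Ricci tensor and the derived curvature tensors *)

(** The trace of a factor metric is 2, so a factor of curvature [k] contributes
    [k * (1 - 2)]. *)
Lemma ricci_nariai (x : 'rV[R]_4) (p q : 'I_4) : U x ->
  ricci g x p q = - (gauss true * E true x p q + gauss false * E false x p q).
Proof.
move=> Ux; rewrite mxE.
transitivity (\sum_a (h x a)^-1 * riemann g x a p q a).
  by apply: eq_bigr => a _; rewrite sum_invmx.
transitivity (\sum_i gauss i * (\sum_a (h x a)^-1 * (E i x p a * E i x a q)
    - E i x p q * \sum_a (h x a)^-1 * E i x a a)).
  under eq_bigr do rewrite riemann_nariai //.
  rewrite big_bool !mulr_sumr -!sumrB !mulr_sumr -big_split.
  apply: eq_bigr => a _ /=.
  by rewrite /block_curvature /riemann_coef !big_bool /=; ring.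
rewrite big_bool !factor_metric_trace //.
rewrite !(factor_metric_contract _ x p (fun a => E _ x a q)) //.
by rewrite !factor_metric_proj !eqxx /=; ring.
Qed.

Lemma scalar_curvature_nariai (x : 'rV[R]_4) : U x ->
  scalar_curvature g x = - 2 * (gauss true + gauss false).
Proof.
move=> Ux; transitivity (- \sum_i gauss i * \sum_a (h x a)^-1 * E i x a a).
  rewrite /scalar_curvature; under eq_bigr do rewrite sum_invmx // ricci_nariai //.
  rewrite big_bool /= !mulr_sumr -big_split -sumrN.
  by apply: eq_bigr => a _ /=; ring.
by rewrite big_bool !factor_metric_trace //=; ring.
Qed.

Definition block_metric (z : bool -> R) : tensor2_field R 4 :=
  fun x => z true *: E true x + z false *: E false x.

Lemma block_metricE (z : bool -> R) (x : 'rV[R]_4) (p q : 'I_4) :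
  block_metric z x p q = z true * E true x p q + z false * E false x p q.
Proof. by rewrite !mxE. Qed.

Lemma nariai_block : g = block_metric (fun=> 1).
Proof.
by apply/funext => x; apply/matrixP => p q; rewrite nariai_sum block_metricE !mul1r.
Qed.

Lemma ricci_block (x : 'rV[R]_4) : U x ->
  ricci g x = block_metric (fun i => - gauss i) x.
Proof.
by move=> Ux; apply/matrixP => p q; rewrite ricci_nariai // block_metricE; ring.
Qed.

Definition projective_coef (i j : bool) : R :=
  riemann_coef i j - gauss i / 3.

Lemma projective_nariai (x : 'rV[R]_4) (p q r s : 'I_4) : U x ->
  projective g x p q r s =
  block_curvature projective_coef x p q r s.
Proof.
move=> Ux; rewrite /projective riemann_nariai // !ricci_nariai // !nariai_sum.
have -> : 4%:R - 1 = 3 :> R by ring.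
by rewrite /block_curvature /projective_coef /riemann_coef !big_bool /=; field.
Qed.

Definition conformal_coef (i j : bool) : R :=
  riemann_coef i j - (gauss i + gauss j) / 2
  + (gauss true + gauss false) / 3.

Lemma conformal_nariai (x : 'rV[R]_4) (p q r s : 'I_4) : U x ->
  conformal g x p q r s =
  block_curvature conformal_coef x p q r s.
Proof.
move=> Ux; rewrite /conformal riemann_nariai // scalar_curvature_nariai //.
rewrite !ricci_nariai // !nariai_sum.
have -> : 4%:R - 1 = 3 :> R by ring.
have -> : 4%:R - 2 = 2 :> R by ring.
by rewrite /block_curvature /conformal_coef /riemann_coef !big_bool /=; field.
Qed.

Definition concircular_coef (i j : bool) : R :=
  riemann_coef i j - (gauss true + gauss false) / 6.

Lemma concircular_nariai (x : 'rV[R]_4) (p q r s : 'I_4) : U x ->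
  concircular g x p q r s =
  block_curvature concircular_coef x p q r s.
Proof.
move=> Ux; rewrite /concircular riemann_nariai // scalar_curvature_nariai //.
rewrite !nariai_sum; have -> : 4%:R - 1 = 3 :> R by ring.
by rewrite /block_curvature /concircular_coef /riemann_coef !big_bool /=; field.
Qed.

Definition conharmonic_coef (i j : bool) : R :=
  riemann_coef i j - (gauss i + gauss j) / 2.

Lemma conharmonic_nariai (x : 'rV[R]_4) (p q r s : 'I_4) : U x ->
  conharmonic g x p q r s =
  block_curvature conharmonic_coef x p q r s.
Proof.
move=> Ux; rewrite /conharmonic riemann_nariai // !ricci_nariai // !nariai_sum.
have -> : 4%:R - 2 = 2 :> R by ring.
by rewrite /block_curvature /conharmonic_coef /riemann_coef !big_bool /=; field.
Qed.

(** * Compatible tensors *)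

Lemma sum_raise (s : tensor2_field R 4) (x : 'rV[R]_4) (i : bool)
    (p u : 'I_4) : U x ->
  \sum_t raise g s x t p * E i x u t = s x u p *+ (factor u == i).
Proof.
move=> Ux; rewrite -(factor_metric_contract _ x _ (fun t => s x t p)) //.
by apply: eq_bigr => t _; rewrite mxE sum_invmx //; ring.
Qed.

Lemma sum_raise_block (b : bool -> bool -> R) (s : tensor2_field R 4)
    (x : 'rV[R]_4) (p q r u : 'I_4) : U x ->
  \sum_t raise g s x t p * block_curvature b x q r u t =
  \sum_i \sum_j b i j * (E i x q u * (s x r p *+ (factor r == j))
                         - E i x r u * (s x q p *+ (factor q == j))).
Proof.
move=> Ux; rewrite !big_bool /= -!(sum_raise s x) //.
rewrite !mulr_sumr -!sumrB !mulr_sumr -!big_split /=.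
by apply: eq_bigr => t _; rewrite /block_curvature !big_bool /=; ring.
Qed.

Lemma block_2_2P (s : 'M[R]_4) :
  block_2_2 s <-> s^T = s /\ forall p q, factor p != factor q -> s p q = 0.
Proof.
split=> [[s11 [s12 [s22 [s33 [s34 [s44 ->]]]]]]|[sC s0]].
  split=> [|p q]; first apply/matrixP => p q; rewrite !mxE;
  by case: p q => -[|[|[|[|//]]]] ? [[|[|[|[|//]]]] ?].
exists (s 0 0), (s 0 1), (s 1 1), (s 2 2), (s 2 3), (s 3 3).
have sE p q : s p q = s q p by rewrite -[in LHS]sC mxE.
apply/matrixP => -[[|[|[|[|//]]]] hp] [[|[|[|[|//]]]] hq]; rewrite mxE /=;
  do ?[by rewrite s0 | by congr (s _ _); apply/val_inj
      | by rewrite sE; congr (s _ _); apply/val_inj].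
Qed.

(** In the cyclic sum [b i j * E i q u] is multiplied by [s r p - s p r], each term
    being kept only if its first index lies in the factor [j]. This vanishes when [s]
    is symmetric and has no mixed entries. Conversely, a mixed entry [s r p] appears
    once with [i = j] and once, with the opposite sign, with [i != j]; hence the
    condition on [b]. *)
Lemma compatible_block_curvature (b : bool -> bool -> R) (B : tensor4_field R 4)
    (s : tensor2_field R 4) :
  b false false != b false true ->
  (forall x p q r u, U x -> B x p q r u = block_curvature b x p q r u) ->
  compatible g U s B <-> (forall x, U x -> block_2_2 (s x)).
Proof.
move=> bneq BE.
have sumE x p q r u : U x ->
  \sum_t (raise g s x t p * B x q r u t + raise g s x t q * B x r p u t
            + raise g s x t r * B x p q u t) =
  \sum_i \sum_j b i j *
    (E i x q u * (s x r p *+ (factor r == j) - s x p r *+ (factor p == j))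
   + E i x r u * (s x p q *+ (factor p == j) - s x q p *+ (factor q == j))
   + E i x p u * (s x q r *+ (factor q == j) - s x r q *+ (factor r == j))).
  move=> Ux; rewrite !big_split /=.
  under eq_bigr do rewrite BE //.
  under [X in _ + X + _]eq_bigr do rewrite BE //.
  under [X in _ + _ + X]eq_bigr do rewrite BE //.
  by rewrite !sum_raise_block // !big_bool /=; ring.
split=> [[sC sB] x Ux|sP].
- have sE p q : s x p q = s x q p by rewrite -[in LHS](sC x Ux) mxE.
  (* [q] is the second direction in the factor of [r]; the component [p q r q]
     of the cyclic sum isolates the mixed entry. *)
  have key (p q r : 'I_4) : factor p -> ~~ factor q -> ~~ factor r -> q != r ->
      s x r p = 0.
    move=> fp fq fr qr; have pq : p != q.
      by apply/eqP => epq; rewrite epq (negbTE fq) in fp.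
    have := sB x Ux p q r q; rewrite sumE // !big_bool /= !mxE.
    rewrite fp (negbTE fq) (negbTE fr) eqxx (eq_sym r) (negbTE qr) (negbTE pq) /=.
    rewrite (sE p r) => H.
    have /eqP : (b false false - b false true) * h x q * s x r p = 0.
      by rewrite -H; ring.
    rewrite !mulf_eq0 subr_eq0 (negbTE bneq) (negbTE (nariai_diag_neq0 _ _ Ux)).
    by move/eqP.
  apply/block_2_2P; split; first exact: sC.
  have key2 (p r : 'I_4) : factor p -> ~~ factor r -> s x r p = 0.
    move=> fp fr; have [r0' | r1] := eqVneq r 0.
      by apply: (key p 1) => //; rewrite r0'.
    by apply: (key p 0) => //; rewrite eq_sym.
  move=> p q; case fp: (factor p); case fq: (factor q) => // _.
    by rewrite sE key2 ?fp ?fq.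
  by rewrite key2 ?fp ?fq.
split=> [x /sP /block_2_2P []//|x Ux p q r u].
have [sC s0] := (block_2_2P _).1 (sP x Ux).
have sE j c d : s x c d *+ (factor c == j) = s x d c *+ (factor d == j).
  have [<-|ne] := eqVneq (factor c) (factor d).
    by rewrite -[in LHS]sC mxE.
  by rewrite !s0 ?mul0rn // eq_sym.
rewrite sumE // big1 // => i _; rewrite big1 // => j _.
by rewrite (sE j r p) (sE j p q) (sE j q r); ring.
Qed.

(** * Action on the Riemann tensor *)

Definition factor_riemann (j : bool) : tensor4_field R 4 := fun x p q r s =>
  gauss j * (E j x p r * E j x q s - E j x q r * E j x p s).
Local Notation riem := (block_curvature riemann_coef).

(** Restricting any one slot of the Riemann tensor to a factor selects the
    curvature tensor of that factor. *)
Lemma riem_proj (x : 'rV[R]_4) (j : bool) (a p q r : 'I_4) :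
  [/\ riem x a p q r *+ (factor a == j) = factor_riemann j x a p q r,
      riem x p a q r *+ (factor a == j) = factor_riemann j x p a q r,
      riem x p q a r *+ (factor a == j) = factor_riemann j x p q a r &
      riem x p q r a *+ (factor a == j) = factor_riemann j x p q r a].
Proof.
have E0 i c : factor a != i -> E i x a c = 0.
  by rewrite mxE => /negbTE ->; rewrite andbF.
have E0' i c : factor a != i -> E i x c a = 0.
  by move=> ai; rewrite factor_metricC E0.
rewrite /block_curvature /factor_riemann /riemann_coef !big_bool /=.
rewrite !mulrb; have [<-|ne] := eqVneq (factor a) j; last first.
  by split; rewrite /= ?(E0 j) ?(E0' j) //; ring.
by have := E0 (~~ factor a); have := E0' (~~ factor a); case: (factor a) => /=;
  move=> Z Z'; split; rewrite ?(Z _ isT) ?(Z' _ isT); ring.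
Qed.

(** The diagonal coefficients do not contribute: the curvature operators of one
    factor are infinitesimal rotations of that factor, which preserve its metric
    and therefore its curvature tensor. *)
Lemma curv_act_block_curvature (b : bool -> bool -> R)
    (B : tensor4_field R 4) (Z : tensor2_field R 4) (x : 'rV[R]_4)
    (p1 p2 p3 p4 r s : 'I_4) : U x ->
  (forall p q r u, B x p q r u = block_curvature b x p q r u) ->
  Z x = block_metric (fun i => b i (~~ i)) x ->
  curv_act g B (riemann g) x p1 p2 p3 p4 r s
  = tachibana Z (riemann g) x p1 p2 p3 p4 r s.
Proof.
move=> Ux BE ZE.
have slot p (F : 'I_4 -> R) :
    \sum_a (h x a)^-1 * (block_curvature b x r s p a * F a) =
    \sum_i \sum_j b i j * (E i x r p * (F s *+ (factor s == j))
                           - E i x s p * (F r *+ (factor r == j))).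
  exact: block_curvature_contract.
have -> : curv_act g B (riemann g) x p1 p2 p3 p4 r s = - (
    \sum_a (h x a)^-1 * (block_curvature b x r s p1 a * riem x a p2 p3 p4)
  + \sum_a (h x a)^-1 * (block_curvature b x r s p2 a * riem x p1 a p3 p4)
  + \sum_a (h x a)^-1 * (block_curvature b x r s p3 a * riem x p1 p2 a p4)
  + \sum_a (h x a)^-1 * (block_curvature b x r s p4 a * riem x p1 p2 p3 a)).
  congr (- _); rewrite -!big_split /=; apply: eq_bigr => a _.
  by rewrite sum_invmx // !BE !riemann_nariai // -!mulrDr.
rewrite !slot !big_bool /=.
have R1 j a p q c : riem x a p q c *+ (factor a == j) = factor_riemann j x a p q c.
  by have [] := riem_proj x j a p q c.
have R2 j a p q c : riem x p a q c *+ (factor a == j) = factor_riemann j x p a q c.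
  by have [] := riem_proj x j a p q c.
have R3 j a p q c : riem x p q a c *+ (factor a == j) = factor_riemann j x p q a c.
  by have [] := riem_proj x j a p q c.
have R4 j a p q c : riem x p q c a *+ (factor a == j) = factor_riemann j x p q c a.
  by have [] := riem_proj x j a p q c.
rewrite !R1 !R2 !R3 !R4 /tachibana ZE !block_metricE !riemann_nariai //.
rewrite /factor_riemann /block_curvature /riemann_coef !big_bool /=.
have C i c d := factor_metricC i x c d.
(* Orient every entry of the symmetric [E i] the same way, for [ring]. *)
rewrite !(C _ r p1) !(C _ r p2) !(C _ r p3) !(C _ r p4).
rewrite !(C _ s p1) !(C _ s p2) !(C _ s p3) !(C _ s p4).
ring.
Qed.

(** * Local symmetry *)

(** The right-hand side is what makes the covariant derivative of [E i] vanish: the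
    metric of each factor of a product is parallel. *)
Lemma is_derive_factor_metric (x : 'rV[R]_4) (i : bool) (m p q : 'I_4) : U x ->
  is_derive x (delta_mx 0 m) (fun y => E i y p q)
    (\sum_a (christoffel g x a m p * E i x a q
             + christoffel g x a m q * E i x p a)).
Proof.
move=> Ux; have EE : (fun y => E i y p q)
    = (fun y => if factor p == i then g y p q else 0).
  by apply/funext => y; rewrite mxE nariaiE; case: (_ == i); rewrite ?andbT ?andbF.
have dE : is_derive x (delta_mx 0 m) (fun y => E i y p q)
    (if factor p == i then nariai_deriv x m p *+ (p == q) else 0).
  by rewrite EE; case: eqVneq => _; [exact: is_derive_nariai|exact: is_derive_cst].
apply: is_derive_eq dE _.
have S k (F : 'I_4 -> R) : \sum_a F a * E i x a k = F k * E i x k k.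
  rewrite -[RHS](sum_delta (fun a => F a * E i x a a)); apply: eq_bigr => a _.
  rewrite [E i x a k]mxE; case: eqVneq => [->|_]; last by rewrite mulr0.
  by rewrite mulr1n mxE eqxx.
rewrite big_split /= S; under [X in _ + X]eq_bigr do rewrite factor_metricC.
rewrite S !christoffel_nariai // !mxE !eqxx /nariai_christoffel /nariai_diag.
rewrite /nariai_deriv /factor_coord /factor.
case: (Ux) => s1 s2; have r0n : r0 != 0 by rewrite gt_eqF.
have L0n : L0 != 0 by rewrite gt_eqF.
case: p q {EE S} => -[|[|[|[|//]]]] ? [[|[|[|[|//]]]] ?];
  case: m => -[|[|[|[|//]]]] ?; case: i => /=;
  by [ring | field; rewrite ?s1 ?s2 ?L0n].
Qed.

Lemma locally_symmetric_nariai : locally_symmetric g U.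
Proof.
move=> x Ux m p q r s; rewrite /nabla4.
rewrite (partial_near _ (fun y => riem y p q r s) m _ x (nbhs_nariai_dom _ Ux));
  last by move=> y Uy; exact: riemann_nariai.
have dE i a b := is_derive_factor_metric x i m a b Ux.
have riemE y a b c d : riem y a b c d =
    gauss true * (E true y a c * E true y b d - E true y b c * E true y a d)
  + gauss false * (E false y a c * E false y b d - E false y b c * E false y a d).
  by rewrite /block_curvature /riemann_coef !big_bool /=; ring.
have [_ Leibniz] : is_derive x (delta_mx 0 m) (fun y => riem y p q r s)
  (\sum_a (christoffel g x a m p * riem x a q r s
    + christoffel g x a m q * riem x p a r s
    + christoffel g x a m r * riem x p q a s
    + christoffel g x a m s * riem x p q r a)).
  rewrite (funext (fun y => riemE y p q r s)).
  apply: is_derive_eq; rewrite /GRing.scale /=.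
  under [RHS]eq_bigr do rewrite !riemE.
  (* Push everything under one sum over the contracted index. *)
  rewrite !(mulr_sumr, =^~ sumrN, =^~ big_split) /=.
  by apply: eq_bigr => a _; ring.
rewrite [partial _ _ _]Leibniz; apply/eqP; rewrite subr_eq0; apply/eqP.
apply: eq_bigr => a _.
by rewrite !riemann_nariai.
Qed.

(** * Conditions on the Ricci tensor *)

Lemma rank_factor_metric (x : 'rV[R]_4) : U x -> \rank (E true x) = 2%N.
Proof.
move=> Ux; pose D : 'M[R]_2 := diag_mx (\row_i h x (rshift 2 i)).
have Du : D \in unitmx.
  rewrite unitmxE unitfE det_diag; apply/prodf_neq0 => i _.
  by rewrite mxE nariai_diag_neq0.
have -> : E true x = block_mx 0 0 0 D :> 'M[R]_(2 + 2).
  rewrite -[LHS](@submxK _ 2 2 2 2); congr block_mx;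
  apply/matrixP => i j; rewrite !mxE;
  by case: i j => -[|[|//]] ? [[|[|//]] ?].
apply: etrans (rank_diag_block_mx (0 : 'M[R]_2) D) _.
by rewrite mxrank0 mxrank_unit.
Qed.

Lemma gauss_lt : L0 < 1 -> gauss false < gauss true.
Proof.
move=> L1; rewrite /gauss ltr_pdivrMr ?exprn_gt0 //.
by rewrite mulVf ?gt_eqF ?exprn_gt0.
Qed.

Lemma quasi_einstein_nariai : L0 < 1 -> quasi_einstein g U 2.
Proof.
move=> L1; exists (fun=> - gauss false); first exact: smooth_cst.
move=> x Ux; have -> : ricci g x - - gauss false *: g x
    = (gauss false - gauss true) *: E true x.
  apply/matrixP => p q.
  by rewrite ricci_block // nariai_block /block_metric !mxE; ring.
rewrite mxrank_scale_nz ?rank_factor_metric //.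
by rewrite subr_eq0 lt_eqF // gauss_lt.
Qed.

(** The Lorentzian factor metric [(r0 ^+ 2 / L0) * (dr^2 - sin^2 r dt^2)] is the
    symmetrized product of the null forms [dr - sin r dt] and [dr + sin r dt]. *)
Lemma chaki_nariai : chaki_quasi_einstein g U.
Proof.
exists (fun=> - gauss true), (fun=> 0),
  (fun=> (gauss true - gauss false) * (r0 ^+ 2 / L0) / 2).
exists (fun x => \row_i [:: -1 * sin (x 0 1); 1; 0; 0]`_i),
  (fun x => \row_i [:: 1 * sin (x 0 1); 1; 0; 0]`_i).
split; first by split; exact: smooth_cst.
have smooth_row (c : R) : smooth_form U
    (fun x => \row_(i < 4) [:: c * sin (x 0 1); 1; 0; 0]`_i : 'rV[R]_4).
  case=> -[|[|[|[|//]]]] i /=; set f := (fun x => _).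
  - have -> : f = (fun x => c * sin (x 0 1)) by apply/funext => x; rewrite /f mxE.
    exact: smooth_sin_coord.
  - have -> : f = (fun=> 1) by apply/funext => x; rewrite /f mxE.
    exact: smooth_cst.
  - have -> : f = (fun=> 0) by apply/funext => x; rewrite /f mxE.
    exact: smooth_cst.
  - have -> : f = (fun=> 0) by apply/funext => x; rewrite /f mxE.
    exact: smooth_cst.
split=> [||x Ux p q]; [exact: smooth_row | exact: smooth_row |].
rewrite ricci_block // block_metricE !mxE /nariai_diag.
by case: p q => -[|[|[|[|//]]]] ? [[|[|[|[|//]]]] ?] /=; field; rewrite gt_eqF.
Qed.

Lemma ricci2_nariai (x : 'rV[R]_4) : U x ->
  ricci2 g x = block_metric (fun i => gauss i ^+ 2) x.
Proof.
move=> Ux; apply/matrixP => p q; rewrite mxE block_metricE.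
have sE i : \sum_t raise g (ricci g) x t q * E i x p t = - gauss i * E i x p q.
  rewrite sum_raise // ricci_block // block_metricE mulrnDl -!mulrnAr.
  by rewrite !factor_metric_proj; case: i => /=; rewrite mulr1n mulr0n; ring.
transitivity (\sum_i - gauss i * \sum_t raise g (ricci g) x t q * E i x p t).
  rewrite big_bool /= !mulr_sumr -big_split; apply: eq_bigr => t _ /=.
  by rewrite ricci_block // block_metricE; ring.
by rewrite big_bool /= !sE; ring.
Qed.

(** The Ricci operator has the two constant eigenvalues [- gauss i], so it is
    annihilated by the corresponding quadratic polynomial. *)
Lemma ein2_nariai : ein2 g U.
Proof.
exists (fun=> 1), (fun=> gauss true + gauss false), (fun=> gauss true * gauss false).
split; first by split; exact: smooth_cst.
move=> x Ux; split; first exact: oner_neq0.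
apply/matrixP => p q.
by rewrite ricci2_nariai // ricci_block // nariai_block /block_metric !mxE; ring.
Qed.

(** On [block_curvature] coefficients, the decomposition asks that
    [- 2 * m1 + m2 * (k i + k j) - 2 * m3 * k i * k j] be [k i] for [i = j] and 0 for
    [i != j], where [k] is [gauss]. This linear system in [m1], [m2], [m3] has a
    unique solution when the two values of [k] differ. *)
Lemma roter_nariai : L0 < 1 -> roter_type g U.
Proof.
move=> L1; have d : gauss true - gauss false != 0.
  by rewrite subr_eq0 gt_eqF // gauss_lt.
pose m3 := - (gauss true + gauss false) / (2 * (gauss true - gauss false) ^+ 2).
pose m2 := 2^-1 + m3 * (gauss true + gauss false).
pose m1 := m2 * (gauss true + gauss false) / 2 - gauss true * gauss false * m3.
exists (fun=> m1), (fun=> m2), (fun=> m3).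
split; first by split; exact: smooth_cst.
move=> x Ux p q r s; rewrite riemann_nariai // /kulkarni_nomizu.
rewrite !ricci_block // nariai_block !block_metricE.
rewrite /block_curvature /riemann_coef !big_bool /= /m1 /m2 /m3.
by field.
Qed.

Lemma compatible_ricci (b : bool -> bool -> R) (B : tensor4_field R 4) :
  b false false != b false true ->
  (forall x p q r u, U x -> B x p q r u = block_curvature b x p q r u) ->
  compatible g U (ricci g) B.
Proof.
move=> bneq BE; apply/(compatible_block_curvature b B) => // x Ux.
apply/block_2_2P; split=> [|p q pq].
  apply/matrixP => p q; rewrite mxE ricci_block // !block_metricE.
  by rewrite !(factor_metricC _ _ q).
have npq : p == q = false by apply: contraNF pq => /eqP ->.
by rewrite ricci_block // block_metricE !mxE npq !mulr0 addr0.
Qed.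

Lemma gauss_gt0 (i : bool) : 0 < gauss i.
Proof.
by case: i; rewrite /gauss; [rewrite invr_gt0|rewrite divr_gt0];
  rewrite ?exprn_gt0.
Qed.

(** The differences are [gauss false] for the Riemann, projective and concircular
    tensors, and half the sum of the two Gauss curvatures for the others. *)
Lemma coef_neq :
  [/\ riemann_coef false false != riemann_coef false true,
      conformal_coef false false != conformal_coef false true,
      projective_coef false false != projective_coef false true,
      concircular_coef false false != concircular_coef false true &
      conharmonic_coef false false != conharmonic_coef false true].
Proof.
have kt := gauss_gt0 true; have kf := gauss_gt0 false.
rewrite /conformal_coef /projective_coef /concircular_coef /conharmonic_coef.
by rewrite /riemann_coef /=; split; rewrite -subr_eq0 gt_eqF //; lra.
Qed.

End Nariai.

Theorem theorem3p1 (R : realType) (r0 L0 : R) (hr0 : 0 < r0)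
    (hL0 : 0 < L0) (hL1 : L0 <= 1) :
  let g := nariai r0 L0 in
  let U := @nariai_dom R in
  (* (i) *)
  locally_symmetric g U /\
  (* (ii); for L0 = 1 the metric is Einstein, and the rank is 0 or 4 *)
  (L0 < 1 -> quasi_einstein g U 2) /\
  (* (iii) *)
  chaki_quasi_einstein g U /\
  (* (iv) *)
  ein2 g U /\
  (* (v); false for L0 = 1, where g ^ g, g ^ S and S ^ S are proportional *)
  (L0 < 1 -> roter_type g U) /\
  (* (vi); signs as determined by the definitions of curv_act and tachibana *)
  (forall x, U x -> forall p1 p2 p3 p4 r s,
     curv_act g (conformal g) (riemann g) x p1 p2 p3 p4 r s
     = - ((1 + L0) / (6 * r0 ^+ 2)) * tachibana g (riemann g) x p1 p2 p3 p4 r s) /\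
  (forall x, U x -> forall p1 p2 p3 p4 r s,
     curv_act g (projective g) (riemann g) x p1 p2 p3 p4 r s
     = 3^-1 * tachibana (ricci g) (riemann g) x p1 p2 p3 p4 r s) /\
  (* (vii) *)
  [/\ compatible g U (ricci g) (riemann g),
      compatible g U (ricci g) (conformal g) &
      compatible g U (ricci g) (projective g)] /\
  (* (viii) *)
  (forall sigma : tensor2_field R 4,
     [/\ compatible g U sigma (riemann g) <-> (forall x, U x -> block_2_2 (sigma x)),
         compatible g U sigma (conformal g) <-> (forall x, U x -> block_2_2 (sigma x)),
         compatible g U sigma (projective g) <-> (forall x, U x -> block_2_2 (sigma x)),
         compatible g U sigma (concircular g) <-> (forall x, U x -> block_2_2 (sigma x)) &
         compatible g U sigma (conharmonic g) <-> (forall x, U x -> block_2_2 (sigma x))]).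
Proof.
move=> g U.
have [neR neC neP neW neK] := coef_neq r0 L0 hr0 hL0.
have RE x p q r s (Ux : U x) := riemann_nariai r0 L0 hr0 hL0 x p q r s Ux.
have CE x p q r s (Ux : U x) := conformal_nariai r0 L0 hr0 hL0 x p q r s Ux.
have PE x p q r s (Ux : U x) := projective_nariai r0 L0 hr0 hL0 x p q r s Ux.
have WE x p q r s (Ux : U x) := concircular_nariai r0 L0 hr0 hL0 x p q r s Ux.
have KE x p q r s (Ux : U x) := conharmonic_nariai r0 L0 hr0 hL0 x p q r s Ux.
have r0n : r0 != 0 by rewrite gt_eqF.
split; first exact: locally_symmetric_nariai.
split; first exact: quasi_einstein_nariai.
split; first exact: chaki_nariai.
split; first exact: ein2_nariai.
split; first exact: roter_nariai.
split.
  move=> x Ux p1 p2 p3 p4 r s.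
  (* Both mixed coefficients of C are minus a sixth of the sum of the Gauss
     curvatures, whence a multiple of [g]. *)
  pose Z y := - ((1 + L0) / (6 * r0 ^+ 2)) *: g y.
  rewrite (curv_act_block_curvature r0 L0 hr0 hL0 _ _ Z x p1 p2 p3 p4 r s Ux
    (fun p q r u => CE x p q r u Ux)).
    have ZE p q : Z x p q = - ((1 + L0) / (6 * r0 ^+ 2)) * g x p q by rewrite mxE.
    rewrite /tachibana !ZE; move: (riemann g x) (g x) => T G; ring.
  rewrite /Z /g (nariai_block r0 L0); apply/matrixP => p q.
  rewrite mxE !block_metricE.
  by rewrite /conformal_coef /riemann_coef /gauss /=; field.
split.
  move=> x Ux p1 p2 p3 p4 r s.
  (* Those of P are minus a third of the Gauss curvatures: a multiple of S. *)
  pose Z y := 3^-1 *: ricci g y.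
  rewrite (curv_act_block_curvature r0 L0 hr0 hL0 _ _ Z x p1 p2 p3 p4 r s Ux
    (fun p q r u => PE x p q r u Ux)).
    have ZE p q : Z x p q = 3^-1 * ricci g x p q by rewrite mxE.
    rewrite /tachibana !ZE; move: (riemann g x) (ricci g x) => T S; ring.
  rewrite /Z ricci_block //; apply/matrixP => p q; rewrite mxE !block_metricE.
  by rewrite /projective_coef /riemann_coef /=; field.
split; first by split; [exact: (compatible_ricci _ _ hr0 hL0 _ _ neR RE)
  | exact: (compatible_ricci _ _ hr0 hL0 _ _ neC CE)
  | exact: (compatible_ricci _ _ hr0 hL0 _ _ neP PE)].
move=> sigma; split.
- exact: (compatible_block_curvature _ _ hr0 hL0 _ _ _ neR RE).
- exact: (compatible_block_curvature _ _ hr0 hL0 _ _ _ neC CE).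
- exact: (compatible_block_curvature _ _ hr0 hL0 _ _ _ neP PE).
- exact: (compatible_block_curvature _ _ hr0 hL0 _ _ _ neW WE).
- exact: (compatible_block_curvature _ _ hr0 hL0 _ _ _ neK KE).
Qed.
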